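(* Consider an inhomogeneous Galton-Watson tree with offspring distributions $(f_n)_{n\ge 0}$ on the non-negative integers, where $f_n$ has finite mean $\mu_n$ and finite variance $\sigma_n^2$. Let $Z$ be the total number of vertices in the tree and $m=\mathbb{E}(Z)$. If there exist a non-negative integer $\tilde n$ and a real number $c$ such that $\mu_n\le c<1$ for all $n>\tilde n$, then $m<\infty$, and hence the number of vertices $Z$ is finite with probability one.
   Context: Inhomogeneous Galton-Watson tree (IGWT): generation $0$ consists of one vertex (the root), so $Z_0=1$, where $Z_n$ denotes the number of vertices in generation $n$. For each $n=0,1,\ldots$, each vertex $i$ in generation $n$ has $X_{n,i}$ offspring, which are vertices of generation $n+1$, where $X_{n,i}$ is drawn from the probability distribution $f_n$ on $\{0,1,2,\ldots\}$ independently of everything else. Thus $Z_{n+1}=\sum_{i=1}^{Z_n}X_{n,i}$, with all $X_{n,i}$ independent and $X_{n,i}\sim f_n$. The construction ends when a generation has no vertices (it may also continue forever). The total number of vertices is $Z=\sum_{n=0}^\infty Z_n\in\{1,2,\ldots\}\cup\{\infty\}$. *)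

(* Defs.v *)
From mathcomp Require Import all_boot all_order all_algebra.
From mathcomp Require Import all_classical all_reals all_analysis.

Set Implicit Arguments.
Unset Strict Implicit.
Unset Printing Implicit Defensive.

Import Order.TTheory GRing.Theory Num.Theory.
Import numFieldNormedType.Exports.

Local Open Scope classical_set_scope.
Local Open Scope ring_scope.
Local Open Scope ereal_scope.

Definition mutually_independent (d d' : measure_display)
    (T : measurableType d) (T' : measurableType d') (R : realType)
    (P : probability T R) (I : eqType) (X : I -> {RV P >-> T'}) : Prop :=
  forall (J : seq I) (A : I -> set T'),
    uniq J -> (forall i, measurable (A i)) ->
    P (\big[setI/setT]_(i <- J) (X i @^-1` A i)) =
    \prod_(i <- J) P (X i @^-1` A i).

(* [X n i] is the number of offspring of the i-th vertex of generation n, the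
   vertices of a generation being numbered from 0.  The variables are given for
   all i; those with i at or beyond the size of generation n are not used. *)
Definition igwt_offspring (d : measure_display) (T : measurableType d)
    (R : realType) (P : probability T R) (f : nat -> probability nat R)
    (X : nat -> nat -> {RV P >-> nat}) : Prop :=
  (forall (n i : nat) (A : set nat),
     measurable A -> distribution P (X n i) A = f n A) /\
  mutually_independent (fun ni : nat * nat => X ni.1 ni.2).

Fixpoint generation_size (x : nat -> nat -> nat) (n : nat) : nat :=
  match n with
  | 0%N => 1%N
  | k.+1 => (\sum_(i < generation_size x k) x k i)%N
  end.

Definition igwt_Z (d : measure_display) (T : measurableType d)
    (R : realType) (P : probability T R) (X : nat -> nat -> {RV P >-> nat})
    (n : nat) (t : T) : nat :=
  generation_size (fun k i => X k i t) n.

Definition igwt_total (d : measure_display) (T : measurableType d)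
    (R : realType) (P : probability T R) (X : nat -> nat -> {RV P >-> nat})
    (t : T) : \bar R :=
  \sum_(0 <= n <oo) (igwt_Z X n t)%:R%:E.

Definition nat_mean (R : realType) (p : probability nat R) : \bar R :=
  'E_p[fun k : nat => k%:R%R].

Definition nat_variance (R : realType) (p : probability nat R) : \bar R :=
  'V_p[fun k : nat => k%:R%R].

(* Main.v *)
(** The size Z_n of generation n is independent of the offspring numbers X_{n,i},
so Z_{n+1} = sum_i 1_{i < Z_n} X_{n,i} gives E(Z_{n+1}) = mu_n E(Z_n). Hence all
E(Z_n) are finite, they eventually decay geometrically, and E(Z), the sum of the
E(Z_n), is finite. *)
Require Import Defs.
From mathcomp Require Import all_boot all_order all_algebra.
From mathcomp Require Import all_classical all_reals all_analysis.
From mathcomp Require Import measurable_realfun ring.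

Set Implicit Arguments.
Unset Strict Implicit.
Unset Printing Implicit Defensive.

Import Order.TTheory GRing.Theory Num.Theory.

Local Open Scope classical_set_scope.
Local Open Scope ring_scope.
Local Open Scope ereal_scope.

(** * Independence of a generation's size from the offspring numbers of that and later
    generations *)

Section generation_independence.
Context (d : measure_display) (T : measurableType d) (R : realType)
  (P : probability T R) (X : nat -> nat -> {RV P >-> nat}).

(** Only the values of [A] on [J] matter, so cylinders over disjoint index lists can share one
    [A]. *)
Definition cylinder (J : seq (nat * nat)) (A : nat * nat -> set nat) : set T :=
  \big[setI/setT]_(m <- J) (X m.1 m.2 @^-1` A m).

Lemma cylinderP J A t :
  cylinder J A t <-> forall m, m \in J -> A m (X m.1 m.2 t).
Proof. by rewrite /cylinder -bigcap_seq. Qed.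

Lemma measurable_preimage_offspring n i (A : set nat) :
  measurable (X n i @^-1` A).
Proof. by rewrite -[_ @^-1` _]setTI; exact: (measurable_funPT (X n i)). Qed.

Lemma measurable_cylinder J A : measurable (cylinder J A).
Proof.
by apply: bigsetI_measurable => m _; exact: measurable_preimage_offspring.
Qed.

Definition family_index n (v : seq nat) : seq (nat * nat) :=
  [seq (n, i) | i <- iota 0 (size v)].

(** The offspring list has random length; fixing the length first leaves finitely many conditions on
    single offspring numbers. The default of [nth] is never read. *)
Lemma generation_family n v :
  [set t | mkseq (fun i => X n i t) (igwt_Z X n t) = v] =
  [set t | igwt_Z X n t = size v] `&`
  cylinder (family_index n v) (fun m => [set nth 0%N v m.2]).
Proof.
apply/seteqP; split=> t /=.
  move=> <-; rewrite size_mkseq; split=> //.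
  apply/cylinderP => m /mapP[i]; rewrite size_mkseq mem_iota/= => ilt -> /=.
  by rewrite nth_mkseq.
move=> [Zv] /cylinderP vX; rewrite Zv; apply: (@eq_from_nth _ 0%N).
  by rewrite size_mkseq.
move=> i; rewrite size_mkseq => ilt; rewrite nth_mkseq//.
by apply: (vX (n, i)); apply/mapP; exists i => //; rewrite mem_iota.
Qed.

Lemma igwt_ZS n t :
  igwt_Z X n.+1 t = sumn (mkseq (fun i => X n i t) (igwt_Z X n t)).
Proof. rewrite sumnE big_map.
by rewrite -[X in iota 0 X]subn0 -/(index_iota _ _) big_mkord. Qed.

(** There are only countably many finite lists of naturals; indexing them by codes gives a union
    that measurability and countable additivity can handle. *)
Lemma igwt_ZS_bigcup n (B : set nat) :
  [set t | B (igwt_Z X n.+1 t)] =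
  \bigcup_(k in [set k | B (sumn (CodeSeq.decode k))])
    [set t | mkseq (fun i => X n i t) (igwt_Z X n t) = CodeSeq.decode k].
Proof.
apply/seteqP; split=> t /=.
  rewrite igwt_ZS => BZ.
  exists (CodeSeq.code (mkseq (fun i => X n i t) (igwt_Z X n t))) => /=;
  by rewrite CodeSeq.codeK.
by move=> [k /= Bk Ek]; rewrite igwt_ZS Ek.
Qed.

Lemma measurable_igwt_Z n (B : set nat) :
  measurable [set t | B (igwt_Z X n t)].
Proof.
elim: n B => [|n IH] B.
  have [B1|B1] := pselect (B 1%N).
    by rewrite (_ : [set _ | _] = setT)//; apply/seteqP; split.
  by rewrite (_ : [set _ | _] = set0)//; apply/seteqP; split.
rewrite igwt_ZS_bigcup; apply: bigcup_measurable => k _.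
rewrite generation_family; apply: measurableI; last exact: measurable_cylinder.
exact: (IH [set size (CodeSeq.decode k)]).
Qed.

Hypothesis indep : mutually_independent (fun m : nat * nat => X m.1 m.2).

Lemma probability_cylinder J A : uniq J ->
  P (cylinder J A) = \prod_(m <- J) P (X m.1 m.2 @^-1` A m).
Proof. by move=> uJ; apply: indep. Qed.

(* Partitioning {Z_n.+1 in B} along the offspring list of generation n (coded by
   a natural number) turns each piece into {Z_n = k} intersected with a cylinder
   over generation n, to which the induction hypothesis applies. *)
Lemma igwt_Z_indep n (B : set nat) J A :
    uniq J -> (forall m, m \in J -> (n <= m.1)%N) ->
  P ([set t | B (igwt_Z X n t)] `&` cylinder J A) =
  P [set t | B (igwt_Z X n t)] * P (cylinder J A).
Proof.
elim: n B J A => [|n IH] B J A uJ Jn.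
  have [B1|B1] := pselect (B 1%N).
    rewrite (_ : [set _ | _] = setT); last by apply/seteqP; split.
    by rewrite setTI probability_setT mul1e.
  rewrite (_ : [set _ | _] = set0); last by apply/seteqP; split.
  by rewrite set0I measure0 mul0e.
set C := cylinder J A.
pose E v := [set t | mkseq (fun i => X n i t) (igwt_Z X n t) = v].
have mE v : measurable (E v).
  rewrite /E generation_family; apply: measurableI.
    exact: (measurable_igwt_Z n [set size v]).
  exact: measurable_cylinder.
have mC : measurable C by exact: measurable_cylinder.
have PEC v : P (E v `&` C) = P C * P (E v).
  rewrite /E generation_family.
  set A1 := fun m : nat * nat => [set nth 0%N v m.2].
  (* The list for [v] lives in generation [n] and [J] in later ones, so [A2] merges both conditions
     into a single cylinder over the concatenated list. *)
  pose A2 m := if m.1 == n then A1 m else A m.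
  have memv m : m \in family_index n v -> m.1 = n by move=> /mapP[i _ ->].
  have cyl1 : cylinder (family_index n v) A1 = cylinder (family_index n v) A2.
    by apply: eq_big_seq => m /memv mn; rewrite /A2 mn eqxx.
  have cyl2 : C = cylinder J A2.
    by apply: eq_big_seq => m /Jn mn; rewrite /A2 gtn_eqF.
  have uv : uniq (family_index n v).
    by rewrite map_inj_uniq ?iota_uniq// => i j [].
  have uvJ : uniq (family_index n v ++ J).
    rewrite cat_uniq uv uJ andbT; apply/hasPn => m /Jn mn.
    by apply/negP => /memv mn'; move: mn; rewrite mn' ltnn.
  rewrite -setIA cyl1 cyl2.
  rewrite [X in _ `&` X](_ : _ = cylinder (family_index n v ++ J) A2); last first.
    by rewrite /cylinder big_cat.
  (* The induction hypothesis is applied to the concatenated list, then to the list for [v] alone;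
     mutual independence factors what remains. *)
  rewrite (IH [set size v])//; last first.
    by move=> m; rewrite mem_cat => /orP[/memv ->//|/Jn/ltnW].
  rewrite (IH [set size v])//; last by move=> m /memv ->.
  rewrite !probability_cylinder// big_cat/=.
  by rewrite muleA muleC.
rewrite igwt_ZS_bigcup.
rewrite -[\bigcup_(k in _) _]/(\bigcup_(k in _) E (CodeSeq.decode k)).
rewrite setI_bigcupl.
have tE D : trivIset D (fun k => E (CodeSeq.decode k)).
  move=> i j _ _ [t [/= Ei Ej]].
  by rewrite -(CodeSeq.decodeK i) -(CodeSeq.decodeK j) -Ei Ej.
rewrite measure_bigcup; last 2 first.
- by move=> k _; exact: measurableI (mE _) mC.
- by move=> i j Di Dj [t [[Ei _] [Ej _]]]; apply: (tE _ i j Di Dj); exists t.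
rewrite measure_bigcup//.

rewrite (eq_eseriesr (fun k _ => PEC (CodeSeq.decode k))).
rewrite -(@fineK _ (P C)) ?fin_num_measure// nneseriesZl//.
by rewrite muleC.
Qed.

End generation_independence.

(** * Natural-number-valued variables: series with indicator factors and the tail-sum formula *)

Lemma nneseries_ltn (R : realType) (x : nat -> nat) n :
  ((\sum_(i < n) x i)%N)%:R%:E =
  \sum_(0 <= i <oo) (((i < n) * x i)%N)%:R%:E :> \bar R.
Proof.
rewrite (nneseries_split 0 n)//.
rewrite add0n eseries0 ?adde0; last first.
  by move=> i ni _; rewrite ltnNge ni mul0n.
rewrite big_mkord natr_sum -sumEFin.
by apply: eq_bigr => i _; rewrite ltn_ord mul1n.
Qed.

Section nat_valued.
Context (d : measure_display) (T : measurableType d) (R : realType).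

Lemma measurable_natr (Y : T -> nat) :
    (forall B : set nat, measurable [set t | B (Y t)]) ->
  measurable_fun [set: T] (fun t => (Y t)%:R%:E : \bar R).
Proof. by move=> mY _ B _; rewrite setTI; exact: (mY [set n | B n%:R%:E]). Qed.

(** [Y] is the sum over all [l] of the indicators of [l < Y], and nonnegative series may be
    integrated term by term. *)
Lemma integral_natr (mu : {measure set T -> \bar R}) (Y : T -> nat) :
    (forall B : set nat, measurable [set t | B (Y t)]) ->
  \int[mu]_t (Y t)%:R%:E = \sum_(0 <= l <oo) mu [set t | (l < Y t)%N].
Proof.
move=> mY.
have mYl l : measurable [set t | (l < Y t)%N] by exact: (mY [set n | (l < n)%N]).
under eq_integral => t _.
  rewrite -{1}(card_ord (Y t)) -sum1_card (nneseries_ltn R (fun=> 1%N)).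
  under eq_eseriesr => k _ do rewrite muln1.
  over.
rewrite integral_nneseries//=.
- apply: eq_eseriesr => l _; rewrite -[X in _ = mu X]setIT -integral_indic//.
  apply: eq_integral => t _; rewrite indicE; congr (_%:R%:E).
  by apply/esym; congr nat_of_bool; apply/idP/idP; rewrite inE.
- by move=> l; apply: measurable_natr => B; exact: (mY [set n | B (l < n)%N]).
Qed.

End nat_valued.

(** * The recursion for the mean generation sizes *)

Section mean.
Context (d : measure_display) (T : measurableType d) (R : realType)
  (P : probability T R) (f : nat -> probability nat R)
  (X : nat -> nat -> {RV P >-> nat}).
Hypothesis offX : igwt_offspring f X.

Lemma integral_igwt_ZS n (m : R) : nat_mean (f n) = m%:E ->
  \int[P]_t (igwt_Z X n.+1 t)%:R%:E = m%:E * \int[P]_t (igwt_Z X n t)%:R%:E.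
Proof.
move=> meanm.
case: offX => distX indepX.
have mZX i (B : set nat) : measurable [set t | B ((i < igwt_Z X n t) * X n i t)%N].
  rewrite (_ : [set _ | _] = [set t | (i < igwt_Z X n t)%N] `&` (X n i @^-1` B)
     `|` [set t | (~~ (i < igwt_Z X n t)%N) /\ B 0%N]); last first.
    apply/seteqP; split=> t /=; case: ltnP => _; rewrite ?(mul1n, mul0n).
    - by left.
    - by right.
    - by case=> [[]|[]].
    - by case=> [[]|[]].
  apply: measurableU.
    apply: measurableI; first exact: (measurable_igwt_Z X n [set k | (i < k)%N]).
    exact: measurable_preimage_offspring.
  exact: (measurable_igwt_Z X n [set k | (~~ (i < k)%N) /\ B 0%N]).
have ZS t : igwt_Z X n.+1 t = (\sum_(i < igwt_Z X n t) X n i t)%N by [].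
(* The random number of summands becomes an indicator factor in a series over all [i], so that sum
   and integral can be exchanged. *)
under eq_integral => t _ do rewrite ZS (nneseries_ltn R (X n ^~ t)).
rewrite integral_nneseries//; last first.
  by move=> i; exact: measurable_natr (mZX i).
have mn : nat_mean (f n) = \sum_(0 <= l <oo) f n [set k | (l < k)%N].
  by rewrite /nat_mean unlock; exact: integral_natr.
have term i : \int[P]_t (((i < igwt_Z X n t) * X n i t)%N)%:R%:E =
    nat_mean (f n) * P [set t | (i < igwt_Z X n t)%N].
  rewrite integral_natr// mn.
  set p := P [set t | _].
  have pfin : p \is a fin_num.
    by apply: fin_num_measure; exact: (measurable_igwt_Z X n [set k | (i < k)%N]).
  rewrite muleC -(fineK pfin) -nneseriesZl//.
  apply: eq_eseriesr => l _; rewrite (fineK pfin) -(distX n i)//.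
  (* Since [l < 0] is impossible, the product exceeds [l] exactly when the indicator is 1 and the
     offspring number exceeds [l]. *)
  rewrite [LHS](_ : _ = P ([set t | (i < igwt_Z X n t)%N] `&`
    cylinder X [:: (n, i)] (fun=> [set k | (l < k)%N]))); last first.
    congr (P _); rewrite /cylinder big_seq1; apply/seteqP; split=> t /=;
    by case: (i < igwt_Z X n t)%N; rewrite ?(mul1n, mul0n)// => -[].
  rewrite (igwt_Z_indep indepX [set k | (i < k)%N])//; last first.
    by move=> ni; rewrite inE => /eqP ->.
  by rewrite /cylinder big_seq1.
under eq_eseriesr => k _ do rewrite term.
rewrite integral_natr; last exact: measurable_igwt_Z.
by rewrite -nneseriesZl// -meanm.
Qed.

End mean.

(** * A ratio test for nonnegative series *)

Lemma nneseries_ratio_lty (R : realType) (a mu : nat -> R) (N : nat) (c : R) :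
    (forall n, 0 <= a n)%R -> (forall n, a n.+1 = mu n * a n)%R ->
    (c < 1)%R -> (forall n, (N < n)%N -> (mu n <= c)%R) ->
  \sum_(0 <= n <oo) (a n)%:E < +oo.
Proof.
move=> a0 aS c1 muc.
pose q := (1 - c)^-1%R.
have q0 : (0 < q)%R by rewrite invr_gt0 subr_gt0.
(* sum_(i < n) a i + a n / (1 - c) is nonincreasing in n > N. *)
pose b n := (\sum_(0 <= i < n) a i + a n * q)%R.
have bS n : (N < n)%N -> (b n.+1 <= b n)%R.
  move=> Nn; rewrite /b big_nat_recr//= -addrA lerD2l aS.
  (* As [q = 1 + c * q], the reserve [a n * q] pays for the new summand [a n] and leaves
     [c * a n * q], which covers [a n.+1 * q]. *)
  have -> : (a n * q = a n + c * a n * q)%R.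
    rewrite -[X in (X + _)%R](mulfK (x := 1 - c)%R) ?subr_eq0 ?gt_eqF// -/q.
    ring.
  by rewrite lerD2l ler_wpM2r ?(ltW q0)// ler_wpM2r// muc.
have bN k : (b (N.+1 + k)%N <= b N.+1)%R.
  elim: k => [|k IH]; first by rewrite addn0.
  by rewrite addnS (le_trans _ IH)// bS// ltnS leq_addr.
apply: (@le_lt_trans _ _ (b N.+1)%:E); last exact: ltry.
apply: lime_le; first by apply: is_cvg_nneseries => n _ _; rewrite lee_fin.
near=> n.
have Nn : (N.+1 <= n)%N by near: n; exact: nbhs_infty_ge.
rewrite sumEFin lee_fin (le_trans _ (bN (n - N.+1)%N))// subnKC// /b.
by rewrite lerDl mulr_ge0// ltW.
Unshelve. all: by end_near. Qed.

Theorem proposition2p3 (d : measure_display) (T : measurableType d)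
    (R : realType) (P : probability T R)
    (f : nat -> probability nat R) (mu sigma : nat -> R)
    (X : nat -> nat -> {RV P >-> nat}) :
  igwt_offspring f X ->
  (forall n : nat, nat_mean (f n) = (mu n)%:E) ->
  (forall n : nat, nat_variance (f n) = (sigma n ^+ 2)%:E) ->
  (exists (N : nat) (c : R),
     (c < 1)%R /\ forall n : nat, (N < n)%N -> (mu n <= c)%R) ->
  \int[P]_t igwt_total X t < +oo /\
  P [set t | igwt_total X t < +oo] = 1.
Proof.
move=> offX meanf _ [N [c [c1 muc]]].
have mZ n : measurable_fun setT (fun t => (igwt_Z X n t)%:R%:E : \bar R).
  by apply: measurable_natr => B; exact: measurable_igwt_Z.
have mtot : measurable_fun setT (igwt_total X).
  exact: (ge0_emeasurable_sum (P := xpredT)).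
have tot0 t : 0 <= igwt_total X t by exact: nneseries_ge0.
have meanS n := integral_igwt_ZS offX (meanf n).
(* Finiteness of each single mean allows passing to real numbers, where the ratio test is stated. *)
have mean_fin n : \int[P]_t (igwt_Z X n t)%:R%:E \is a fin_num.
  elim: n => [|n IH]; last by rewrite meanS fin_numM.
  rewrite -[X in X \is a _]/(\int[P]_t cst 1 t).
  by rewrite integral_cst// fin_numM// fin_num_measure.
have int_lty : \int[P]_t igwt_total X t < +oo.
  rewrite integral_nneseries//.
  under eq_eseriesr => k _ do rewrite -(fineK (mean_fin _)).
  apply: (nneseries_ratio_lty (mu := mu)) c1 muc.
  - by move=> n; rewrite fine_ge0// integral_ge0.
  - by move=> n; rewrite meanS fineM.
split=> //.
(* An integrable function is finite almost everywhere. *)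
have /(integrable_ae measurableT) : P.-integrable setT (igwt_total X).
  apply/integrableP; split=> //.
  by under eq_integral do rewrite gee0_abs//.
have mfin : measurable [set t | igwt_total X t < +oo].
  rewrite -[X in measurable X]setTI; exact: emeasurable_fun_infty_o.
(* For a nonnegative value, being finite means being below [+oo]; the exceptional set is thus the
   complement of the event in the goal. *)
have -> : (\forall t \ae P, setT t -> igwt_total X t \is a fin_num) =
    P.-negligible (~` [set t | igwt_total X t < +oo]).
  congr (P.-negligible _); apply/seteqP; split=> t /=.
    by apply: contra_not => tfin _; rewrite ge0_fin_numE.
  by apply: contra_not => /(_ I); rewrite ge0_fin_numE.
move=> /(negligibleP P (measurableC mfin)) P0.
by rewrite -[X in P X]setCK probability_setC ?P0 ?sube0//; exact: measurableC.
Qed.
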